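(* Let $n\ge 1$ and let $a_{i,j},b_{i,j}>0$ be arbitrary positive weights. Let $K_n$ be the (ordered) Kasteleyn matrix of the Aztec diamond of size $n$, and set $A_n=K_n[1;n,1;n]$, $B_n=K_n[1;n,n+1;n(n+1)]$, $C_n=K_n[n+1;n(n+1),1;n]$ and $D_n=K_n[n+1;n(n+1),n+1;n(n+1)]$. For $1\le i,j\le n$ let $$\tilde w_{ij}=(A_n-B_nD_n^{-1}C_n)(i,j)$$ and $\tilde W_n^{\mathrm{Az}}=(\tilde w_{ij})_{1\le i,j\le n}$. Let $W_n^{\mathrm{Az}}=(w_{ij})_{1\le i,j\le n}$ be the matrix whose entry $w_{ij}$ is the weighted number of directed paths from $(0,2i-1)$ to $(2j,-1)$ in the DR graph of the Aztec diamond. Then $w_{ij}=|\tilde w_{ij}|$ for all $1\le i,j\le n$, and $\det W_n^{\mathrm{Az}}=|\det\tilde W_n^{\mathrm{Az}}|$. Moreover $$K_n^{-1}=\begin{pmatrix}(\tilde W_n^{\mathrm{Az}})^{-1} & -(\tilde W_n^{\mathrm{Az}})^{-1}B_nD_n^{-1}\\ -D_n^{-1}C_n(\tilde W_n^{\mathrm{Az}})^{-1} & D_n^{-1}+D_n^{-1}C_n(\tilde W_n^{\mathrm{Az}})^{-1}B_nD_n^{-1}\end{pmatrix}.$$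
   Context: Aztec diamond graph of size $n$: white vertices $\mathtt W=\{(2j+1,2k):0\le j\le n-1,\ 0\le k\le n\}$, black vertices $\mathtt B=\{(2j,2k+1):0\le j\le n,\ 0\le k\le n-1\}$; a black and a white vertex are joined by an edge iff they differ by $(\pm1,\pm1)$. Edge weights: for a black vertex $x=(2r,2s+1)$ and a white neighbour $y$, the weight of the edge is $1$ if $y-x=(-1,-1)$ or $y-x=(-1,1)$, it is $a_{r,s}$ if $y-x=(1,1)$, and $b_{r,s}$ if $y-x=(1,-1)$. Kasteleyn matrix $K_n^{\mathrm{Az}}:\mathtt B\times\mathtt W\to\mathbb C$: for $x=(2r,2s+1)\in\mathtt B$, $y\in\mathtt W$, $K_n^{\mathrm{Az}}(x,y)$ equals $1$ if $y-x=(-1,-1)$, $\mathrm i$ if $y-x=(-1,1)$, $a_{r,s}$ if $y-x=(1,1)$, $\mathrm i\,b_{r,s}$ if $y-x=(1,-1)$, and $0$ otherwise. Ordering of vertices: for $1\le i\le n(n+1)$, with $[i]_n=i\bmod n\in\{0,\dots,n-1\}$, put $w(i)=(2i-1,0)$ if $1\le i\le n$ and $w(i)=(2[i-1]_n+1,\,2n+2-2\lfloor\frac{i-1}{n}\rfloor)$ otherwise; $b(i)=(0,2i-1)$ if $1\le i\le n$ and $b(i)=(2[i-1]_n+2,\,2n+1-2\lfloor\frac{i-1}{n}\rfloor)$ otherwise. The ordered Kasteleyn matrix is $K_n=(K_n^{\mathrm{Az}}(b(i),w(j)))_{1\le i,j\le n(n+1)}$. For a matrix $M$, $M[i;j,k;l]$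 denotes the submatrix with rows $i$ through $j$ and columns $k$ through $l$. DR graph: the weighted directed graph with vertex set $\{(2j,2k-1):0\le j\le n,\ 0\le k\le n\}$ whose directed edges are those corresponding to edges of the Aztec diamond graph as follows: for every edge of the Aztec diamond between a black vertex $x$ and a white vertex $y$ with $y-x\ne(-1,1)$ there is a directed edge from $x$ to $y+(1,-1)$, carrying the weight of that edge of the Aztec diamond. (So a step is $x\to x+(2,0)$, $x\to x+(2,-2)$ or $x\to x+(0,-2)$.) The weight of a path is the product of the weights of its edges, and the weighted number of paths is the sum of the weights of the paths. *)

(* Defs.v *)
(* Mathematical Components; the complex numbers are R[i] over a real closed
   field R, from mathcomp-real-closed. *)
From HB Require Import structures.
From mathcomp Require Import all_boot all_order all_algebra.
From mathcomp.real_closed Require Import complex.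
From mathcomp Require Import zify.

Set Implicit Arguments.
Unset Strict Implicit.
Unset Printing Implicit Defensive.

Import Order.TTheory GRing.Theory Num.Theory.
Local Open Scope ring_scope.

(* Both graphs live in the lattice int * int, with its componentwise group
   structure, so that y - x is the displacement from x to y. *)
Definition point : Type := (int * int)%type.

Section AztecDiamond.
Variable n : nat.

Definition az_white (y : point) : bool :=
  [exists j : 'I_n, exists k : 'I_n.+1,
     y == (2 * (j : nat)%:Z + 1, 2 * (k : nat)%:Z)].

Definition az_black (x : point) : bool :=
  [exists j : 'I_n.+1, exists k : 'I_n,
     x == (2 * (j : nat)%:Z, 2 * (k : nat)%:Z + 1)].

Definition az_edge (x y : point) : bool :=
  [&& az_black x, az_white y &
      y - x \in ([:: (1, 1); (1, -1); (-1, 1); (-1, -1)] : seq point)].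

(* A black vertex x = (2r, 2s+1) has the label (r, s). *)
Definition black_r (x : point) : nat := `|x.1|%N./2.
Definition black_s (x : point) : nat := `|x.2|%N./2.

Lemma black_rE (r s : nat) : black_r (2 * r%:Z, 2 * s%:Z + 1) = r.
Proof. rewrite /black_r /=; lia. Qed.

Lemma black_sE (r s : nat) : black_s (2 * r%:Z, 2 * s%:Z + 1) = s.
Proof. rewrite /black_s /=; lia. Qed.

(* The vertices b(i) and w(i), for 1 <= i <= n(n+1). *)
Definition wvert (i : nat) : point :=
  if (i <= n)%N then (2 * i%:Z - 1, 0)
  else (2 * ((i - 1) %% n)%N%:Z + 1,
        2 * n%:Z + 2 - 2 * ((i - 1) %/ n)%N%:Z).

Definition bvert (i : nat) : point :=
  if (i <= n)%N then (0, 2 * i%:Z - 1)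
  else (2 * ((i - 1) %% n)%N%:Z + 2,
        2 * n%:Z + 1 - 2 * ((i - 1) %/ n)%N%:Z).

Lemma wvert_white (i : nat) :
  (1 <= i <= n * n.+1)%N -> az_white (wvert i).
Proof.
move=> /andP[i1 iN]; have n0 : (0 < n)%N by case: n iN => // /(leq_trans i1).
rewrite /az_white /wvert; case: leqP => hi.
  have h : (i.-1 < n)%N by lia.
  apply/existsP; exists (Ordinal h); apply/existsP; exists ord0.
  by apply/eqP; congr pair => /=; lia.
have hq1 : (1 <= (i - 1) %/ n)%N by rewrite divn_gt0 //; lia.
have hq2 : ((i - 1) %/ n < n.+1)%N by rewrite ltn_divLR //; lia.
have h : (n.+1 - (i - 1) %/ n < n.+1)%N by lia.
apply/existsP; exists (Ordinal (ltn_pmod (i - 1) n0)).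
apply/existsP; exists (Ordinal h).
by apply/eqP; congr pair => /=; lia.
Qed.

Lemma bvert_black (i : nat) :
  (1 <= i <= n * n.+1)%N -> az_black (bvert i).
Proof.
move=> /andP[i1 iN]; have n0 : (0 < n)%N by case: n iN => // /(leq_trans i1).
rewrite /az_black /bvert; case: leqP => hi.
  have h : (i.-1 < n)%N by lia.
  apply/existsP; exists ord0; apply/existsP; exists (Ordinal h).
  by apply/eqP; congr pair => /=; lia.
have hq1 : (1 <= (i - 1) %/ n)%N by rewrite divn_gt0 //; lia.
have hq2 : ((i - 1) %/ n < n.+1)%N by rewrite ltn_divLR //; lia.
have h : (n - (i - 1) %/ n < n)%N by lia.
have h' : (((i - 1) %% n).+1 < n.+1)%N by rewrite ltnS ltn_pmod.
apply/existsP; exists (Ordinal h').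
apply/existsP; exists (Ordinal h).
by apply/eqP; congr pair => /=; lia.
Qed.

(* The vertex (j, k) stands for the point (2j, 2k-1). *)
Definition dr_vertex : finType := ('I_n.+1 * 'I_n.+1)%type.
Definition dr_point (u : dr_vertex) : point :=
  (2 * (u.1 : nat)%:Z, 2 * (u.2 : nat)%:Z - 1).

(* The Aztec edge (x, y) gives the directed edge from x to y + (1, -1). *)
Definition dr_white (v : dr_vertex) : point := dr_point v - (1, -1).
Definition dr_edge (u v : dr_vertex) : bool :=
  az_edge (dr_point u) (dr_white v)
    && (dr_white v - dr_point u != (-1, 1) :> point).

Lemma dr_edge_target (x y : point) :
  az_edge x y -> y - x != (-1, 1) ->
  exists u v : dr_vertex, [/\ dr_point u = x, dr_white v = y & dr_edge u v].
Proof.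
move=> e ne; have /and3P[/existsP[j /existsP[k /eqP xE]]] := e.
move=> /existsP[j' /existsP[k' /eqP yE]] _.
have hk : (k.+1 < n.+1)%N by rewrite ltnS.
have hj : (j'.+1 < n.+1)%N by rewrite ltnS.
have uE : dr_point (j, Ordinal hk) = x.
  by rewrite xE /dr_point; congr pair => /=; lia.
have vE : dr_white (Ordinal hj, k') = y.
  rewrite yE /dr_white /dr_point; congr pair => /=; lia.
exists (j, Ordinal hk), (Ordinal hj, k'); split=> //.
by rewrite /dr_edge uE vE e.
Qed.

Lemma dr_edge_lt (u v : dr_vertex) : dr_edge u v ->
  (dr_point u).1 - (dr_point u).2 < (dr_point v).1 - (dr_point v).2.
Proof.
case/andP=> /and3P[_ _]; rewrite /dr_white !inE.
case: (dr_point u) (dr_point v) => [x1 x2] [z1 z2] /=.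
rewrite -!pair_eqE /pair_eq /=; lia.
Qed.

(* The DR graph is acyclic, so its paths have fewer than #|dr_vertex| steps. *)
Lemma dr_path_size (u : dr_vertex) (p : seq dr_vertex) :
  path dr_edge u p -> (size p < #|dr_vertex|)%N.
Proof.
pose h (v : dr_vertex) := (dr_point v).1 - (dr_point v).2.
move=> up; have s : sorted <%R (map h (u :: p)).
  rewrite sorted_map; apply: (sub_path _ up) => v w; exact: dr_edge_lt.
have /card_uniqP uniq_up : uniq (u :: p).
  exact: map_uniq (sorted_uniq lt_trans ltxx s).
by rewrite -[X in (X <= _)%N]/(size (u :: p)) -uniq_up max_card.
Qed.

End AztecDiamond.

Section Weights.
Variables (R : rcfType) (n : nat) (a b : nat -> nat -> R).

Definition az_weight (x y : point) : R :=
  if y - x == (-1, -1) :> point then 1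
  else if y - x == (-1, 1) :> point then 1
  else if y - x == (1, 1) :> point then a (black_r x) (black_s x)
  else if y - x == (1, -1) :> point then b (black_r x) (black_s x)
  else 0.

Definition kasteleyn (x y : point) : R[i] :=
  if y - x == (-1, -1) :> point then 1
  else if y - x == (-1, 1) :> point then 'i%C
  else if y - x == (1, 1) :> point then (a (black_r x) (black_s x))%:C%C
  else if y - x == (1, -1) :> point
       then 'i%C * (b (black_r x) (black_s x))%:C%C
  else 0.

(* The index set of size n(n+1) is written 'I_(n + n * n) to expose the block
   decomposition; the ordinal i is the index i.+1 of the ordering. *)
Definition kasteleyn_mx : 'M[R[i]]_(n + n * n) :=
  \matrix_(i, j) kasteleyn (bvert n i.+1) (wvert n j.+1).

Definition dr_weight (u v : dr_vertex n) : R :=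
  az_weight (dr_point u) (dr_white v).

Definition path_weight (u : dr_vertex n) (p : seq (dr_vertex n)) : R :=
  \prod_(e <- zip (u :: p) p) dr_weight e.1 e.2.

(* By dr_path_size, the sum ranges over all directed paths from u to v. *)
Definition weighted_paths (u v : dr_vertex n) : R :=
  \sum_(l < #|dr_vertex n|)
    \sum_(p : l.-tuple (dr_vertex n) |
            path (@dr_edge n) u p && (last u p == v)) path_weight u p.

(* The ordinals i, j stand for i.+1, j.+1: lift ord0 i has value i.+1. *)
Definition path_mx : 'M[R]_n :=
  \matrix_(i, j) weighted_paths (ord0, lift ord0 i) (lift ord0 j, ord0).

End Weights.

Lemma dr_sourceE (n : nat) (i : 'I_n) :
  dr_point (ord0, lift ord0 i) = (0, 2 * i.+1%:Z - 1).
Proof. by []. Qed.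

Lemma dr_sinkE (n : nat) (j : 'I_n) :
  dr_point (lift ord0 j, ord0) = (2 * j.+1%:Z, -1).
Proof. by []. Qed.

(* Main.v *)
Require Import Defs.
From HB Require Import structures.
From mathcomp Require Import all_boot all_order all_algebra.
From mathcomp.real_closed Require Import complex.
From mathcomp Require Import zify ring.

Set Implicit Arguments.
Unset Strict Implicit.
Unset Printing Implicit Defensive.

Import Order.TTheory GRing.Theory Num.Theory.
Local Open Scope ring_scope.

(** The theorem has an algebraic half and a positivity half.

    Algebra.  Moving each white vertex [y] to [y + (1, -1)] turns the Aztec
    diamond into the DR graph: an interior DR vertex is at once a black and a
    white vertex, the edges of displacement (-1, 1) become loops at the
    interior vertices, with entry [i] in [K], and the other edges become the
    steps of the DR graph.  Up to the gauge factor [i ^ (s - r)] at the vertex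
    [(r, s)], the matrix [K] is therefore [i] times (loops minus steps)
    ([kasteleyn_edge]).  The chosen ordering increases along the steps
    ([interior_edge_lt]), so that [D] is triangular with [i] on its diagonal.
    The weighted numbers of paths to a fixed sink satisfy the first-step
    recurrence ([weighted_paths_recl]), that is, they are annihilated by
    (loops minus steps) in all interior rows.  Inserted with their gauge
    factors as columns, they solve [K Y = (M; 0)] where [Y] has identity top
    block and [M] is [W] with its entry of row [k] and column [l], counted from
    1, multiplied by the unit [- i * i ^ k * i ^ l]
    ([mul_kasteleyn_solution]).  Eliminating the bottom
    block of [Y] shows that [M] is the Schur complement of [D] in [K], and
    absolute values turn [M] into [|W|] and [det M] into [|det W|].

    Positivity.  It remains to see that [W] has nonnegative entries and that
    [0 < det W]; the latter also makes the Schur complement invertible, and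
    the formula for the inverse of [K] is then the usual block inversion
    ([block_mx_inv_schur]).  The determinant is handled by urban renewal: it
    equals a product of positive numbers times the determinant for the Aztec
    diamond of size [n - 1] with new positive weights ([det_sink_mx]).
    To see this, write a column of [W] as an alternating composition of linear
    operators on functions of the height ([sink_col], [path_mx_sink_mx]):
    cross from one column of the graph to the next, move down along it,
    cross again, and so on.  One crossing can be exchanged with one descent,
    up to a diagonal factor ([crossing_descent]).  Doing so in all columns of
    the graph regroups the remaining factors into the crossings of a smaller
    network, up to operations on the columns of [W] ([thinned_sink_col]). *)

(** * Urban renewal for the columns of the path matrix *)

Section Renewal.
Variable F : fieldType.
Implicit Types (f g al be : nat -> F) (a b : nat -> nat -> F).

(** The functions [nat -> F] give, at each height of a column of the DR graph,
    the weight of continuing from there to the sink.  Operators pull such a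
    function back along one stage of the paths.  Heights never increase along
    a path, so each value involves finitely many others and no bound on the
    heights has to be imposed.  A source of height [s + 1] has index [s],
    hence the diagonal step to index [s] and the horizontal one to [s + 1]. *)
Definition crossing al be f : nat -> F := fun s => be s * f s + al s * f s.+1.

Definition descent f : nat -> F := fun s => \sum_(t < s.+1) f t.

(** No step leaves a vertex of height 0, so that only the heights [t + 1]
    serve as starting points, with index [t], of the next crossing. *)
Definition raise f : nat -> F := fun s => if s is t.+1 then f t else 0.

Definition bottom : nat -> F := fun s => (s == 0%N)%:R.

Definition tail a : nat -> nat -> F := fun r => a r.+1.

(** As a function of [i], this is the weight of all paths from [(0, i + 1)] to
    the sink [(j + 1, 0)], decomposed at each change of column. *)
Fixpoint sink_col a b (j : nat) : nat -> F :=
  crossing (a 0%N) (b 0%N)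
    (descent (if j is k.+1 then raise (sink_col (tail a) (tail b) k)
              else bottom)).

Definition sink_mx a b n : 'M[F]_n := \matrix_(i, j) sink_col a b j i.

Lemma eq_crossing al be f g : f =1 g -> crossing al be f =1 crossing al be g.
Proof. by move=> fg s; rewrite /crossing !fg. Qed.

Lemma eq_descent f g : f =1 g -> descent f =1 descent g.
Proof. by move=> fg s; apply: eq_bigr => t _; rewrite fg. Qed.

(** Paths go down and to the right, and so meet only the weights listed here;
    this allows weights outside the diamond to be changed freely. *)
Lemma eq_sink_col a b a' b' j s :
  (forall r t, (r <= j)%N -> (t <= s)%N -> a r t = a' r t) ->
  (forall r t, (r <= j)%N -> (t <= s)%N -> b r t = b' r t) ->
  sink_col a b j s = sink_col a' b' j s.
Proof.
elim: j s a b a' b' => [|j IHj] s a b a' b' ha hb.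
  by rewrite /= /crossing ha // hb.
rewrite /= /crossing ha // hb //.
have E t : (t <= s.+1)%N -> raise (sink_col (tail a) (tail b) j) t
                         = raise (sink_col (tail a') (tail b') j) t.
  case: t => //= t ht; apply: IHj => r v hr hv; [apply: ha | apply: hb] => //; lia.
by congr (_ * _ + _ * _); apply: eq_bigr => t _; apply: E; case: t => /=; lia.
Qed.

(** [right_prob] and [diag_prob] are the probabilities of the two ways of
    crossing at a black vertex when its weights are normalised to sum 1. *)
Definition total_wt a b r s := a r s + b r s.
Definition right_prob a b r s := a r s / total_wt a b r s.
Definition diag_prob a b r s := b r s / total_wt a b r s.

Lemma diag_probE a b r s : total_wt a b r s != 0 ->
  diag_prob a b r s = 1 - right_prob a b r s.
Proof. by move=> c0; apply/eqP; rewrite eq_sym subr_eq -mulrDl addrC divff. Qed.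

(** The weights of the smaller diamond.  A crossing of the smaller network is
    a normalised crossing out of column [r], weighted by the total weights left
    over from the crossing out of column [r + 1]. *)
Definition renewed_a a b : nat -> nat -> F :=
  fun r s => right_prob a b r s.+1 * total_wt a b r.+1 s.+1.
Definition renewed_b a b : nat -> nat -> F :=
  fun r s => diag_prob a b r s * total_wt a b r.+1 s.

(** The crossing that remains after the exchange in [crossing_descent].  The
    diagonal step with the probability of the black vertex [t] is now attached
    to the index [t + 1], and a step of weight 1 takes its place at index 0. *)
Definition swapped a b f : nat -> F := fun s =>
  if s is t.+1 then diag_prob a b 0 t * f t.+1 + right_prob a b 0 t.+1 * f t.+2
  else f 0%N + right_prob a b 0 0 * f 1%N.

(** The exchange at the heart of urban renewal.  Since the two probabilities
    sum to 1, the partial sums of [swapped a b f] telescope: the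
    value [f t.+1] receives [p_t] from the index [t] and [1 - p_t] from the
    index [t + 1], except at the top end, where [p_s] alone remains. *)
Lemma crossing_descent a b f s : (forall t, total_wt a b 0 t != 0) ->
  crossing (a 0%N) (b 0%N) (descent f) s =
  total_wt a b 0 s * descent (swapped a b f) s.
Proof.
move=> c0.
have -> : descent (swapped a b f) s = descent f s + right_prob a b 0 s * f s.+1.
  rewrite /descent; elim: s => [|s IHs]; first by rewrite !big_ord1.
  rewrite big_ord_recr IHs [\sum_(t < s.+2) f t]big_ord_recr /=.
  by rewrite /= diag_probE //; ring.
rewrite /crossing [descent f s.+1]big_ord_recr /= -/(descent f s).
have -> : a 0%N s = total_wt a b 0 s * right_prob a b 0 s by rewrite mulrC divfK.
have -> : b 0%N s = total_wt a b 0 s * diag_prob a b 0 s by rewrite mulrC divfK.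
suff -> : diag_prob a b 0 s = 1 - right_prob a b 0 s by ring.
exact: diag_probE.
Qed.

Lemma swapped_bottom a b : swapped a b bottom =1 bottom.
Proof. by case=> [|s]; rewrite /swapped /bottom /= ?mulr0 ?addr0. Qed.

(** The part of [swapped] that avoids the bottom vertex; it maps functions to
    functions on one height fewer, which is how the size drops by one. *)
Definition thinned a b : (nat -> F) -> nat -> F :=
  crossing (fun s => right_prob a b 0 s.+1) (diag_prob a b 0).

Lemma swapped_raise a b f s : swapped a b (raise f) s =
  right_prob a b 0 0 * f 0%N * bottom s + raise (thinned a b f) s.
Proof.
by case: s => [|s]; rewrite /swapped /bottom /= ?add0r ?mulr1 ?addr0 ?mulr0 ?add0r.
Qed.

(** Coefficients of the column operations: entry [k], [j] of a unitriangular
    matrix.  The off-diagonal ones record the multiple of [bottom] in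
    [swapped_raise], which contributes multiples of earlier renewed columns. *)
Fixpoint mixing a b (j k : nat) : F :=
  match j, k with
  | 0%N, _ => (k == 0%N)%:R
  | j'.+1, 0%N =>
      right_prob (tail a) (tail b) 0 0 * sink_col (tail (tail a)) (tail (tail b)) j' 0
  | j'.+1, k'.+1 => mixing (tail a) (tail b) j' k'
  end.

Lemma mixing_diag a b j : mixing a b j j = 1.
Proof. by elim: j a b => //= j IHj a b. Qed.

Lemma mixing_gt a b j k : (j < k)%N -> mixing a b j k = 0.
Proof. by elim: j k a b => [|j IHj] [|k] a b //= /IHj. Qed.

Lemma thinned_total a b f s :
  thinned a b (fun t => total_wt a b 1 t * f t) s =
  crossing (renewed_a a b 0%N) (renewed_b a b 0%N) f s.
Proof. by rewrite /thinned /crossing !mulrA. Qed.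

Lemma descent_lin f g u s :
  descent (fun t => u * f t + g t) s = u * descent f s + descent g s.
Proof. by rewrite /descent big_split mulr_sumr. Qed.

Lemma crossing_lin al be f g u s :
  crossing al be (fun t => u * f t + g t) s =
  u * crossing al be f s + crossing al be g s.
Proof. by rewrite /crossing; ring. Qed.

Lemma crossing_sum al be m (u : 'I_m -> F) (f : 'I_m -> nat -> F) s :
  crossing al be (descent (raise (fun t => \sum_k u k * f k t))) s =
  \sum_k u k * crossing al be (descent (raise (f k))) s.
Proof.
have E t : descent (raise (fun t => \sum_k u k * f k t)) t =
           \sum_k u k * descent (raise (f k)) t.
  rewrite /descent; under [RHS]eq_bigr do rewrite mulr_sumr.
  rewrite exchange_big; apply: eq_bigr => -[[|v] hv] _ //=.
  by rewrite big1 // => k _; rewrite mulr0.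
rewrite /crossing !E !mulr_sumr -big_split /=; apply: eq_bigr => k _; ring.
Qed.

Lemma sink_col_recl a b j : sink_col a b j.+1 =
  crossing (a 0%N) (b 0%N) (descent (raise (sink_col (tail a) (tail b) j))).
Proof. by []. Qed.

(** Exchanging crossing and descent in the first factor of a column leaves the
    first crossing of the renewed network followed by a descent and by
    [swapped] acting on the remaining factors; the latter is again [thinned],
    and induction applies, up to a multiple of [bottom], which
    produces the renewed column 0. *)
Lemma thinned_sink_col a b j s : (forall r t, total_wt a b r t != 0) ->
  thinned a b (sink_col (tail a) (tail b) j) s =
  \sum_(k < j.+1) mixing a b j k * sink_col (renewed_a a b) (renewed_b a b) k s.
Proof.
elim: j a b s => [|j IHj] a b s c0.
  rewrite big_ord1 mul1r -[RHS]thinned_total; apply: eq_crossing => t.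
  rewrite [LHS]crossing_descent; last by move=> v; exact: c0.
  by congr (_ * _); apply: eq_descent => v; exact: swapped_bottom.
rewrite big_ord_recl.
under eq_bigr do rewrite sink_col_recl.
rewrite -(crossing_sum _ _ (fun k : 'I_j.+1 => mixing (tail a) (tail b) j k)
   (fun k => sink_col (tail (renewed_a a b)) (tail (renewed_b a b)) k)).
rewrite [sink_col _ _ ord0]/= -crossing_lin -thinned_total.
apply: eq_crossing => t; rewrite [LHS]crossing_descent; last by move=> v; exact: c0.
congr (_ * _); rewrite -descent_lin; apply: eq_descent => v.
rewrite swapped_raise; congr (_ + _); case: v => //= v.
by apply: IHj => r w; exact: c0.
Qed.

(** After the exchange, [sink_mx] is a diagonal matrix of total weights, times
    the unitriangular matrix of [descent], times a matrix whose column 0 is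
    the first basis vector.  Striking out the row and the column of that
    vector leaves the renewed matrix times the unitriangular [mixing]. *)
Lemma det_sink_mx a b n : (forall r t, total_wt a b r t != 0) ->
  \det (sink_mx a b n.+1) = (\prod_(s < n.+1) total_wt a b 0 s)
     * \det (sink_mx (renewed_a a b) (renewed_b a b) n).
Proof.
move=> c0.
pose g j := swapped a b
  (if j is k.+1 then raise (sink_col (tail a) (tail b) k) else bottom).
pose L : 'M[F]_n.+1 := \matrix_(i, j) (j <= i)%:R.
pose G : 'M[F]_n.+1 := \matrix_(i, j) g j i.
pose U : 'M[F]_n := \matrix_(k, j) mixing a b j k.
have -> : sink_mx a b n.+1 = diag_mx (\row_s total_wt a b 0 s) *m (L *m G).
  apply/matrixP => i j; rewrite mul_diag_mx !mxE.
  transitivity (total_wt a b 0 i * descent (g j) i).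
    by rewrite -crossing_descent //; case: j => -[|j] hj.
  congr (_ * _); rewrite /descent (big_ord_widen _ (g j) (ltn_ord i)) big_mkcond /=.
  by apply: eq_bigr => t _; rewrite !mxE ltnS; case: leqP; rewrite ?mul1r ?mul0r.
have detL : \det L = 1.
  rewrite det_trig; first by rewrite big1 // => i _; rewrite mxE leqnn.
  by apply/is_trig_mxP => i j ij; rewrite mxE leqNgt ij.
have detU : \det U = 1.
  rewrite -det_tr det_trig.
    by rewrite big1 // => i _; rewrite !mxE mixing_diag.
  by apply/is_trig_mxP => i j ij; rewrite !mxE mixing_gt.
rewrite !det_mulmx detL mul1r det_diag.
congr (_ * _); first by apply: eq_bigr => s _; rewrite mxE.
rewrite (expand_det_col G ord0) big_ord_recl big1 ?addr0; last first.
  by move=> i _; rewrite mxE /g swapped_bottom /bottom mul0r.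
rewrite mxE /g swapped_bottom /bottom mul1r /cofactor expr0 mul1r.
rewrite -[RHS]mulr1 -detU -det_mulmx; congr (\det _).
apply/matrixP => i j; rewrite !mxE /g !lift0 swapped_raise /bottom mulr0 add0r.
rewrite [LHS]thinned_sink_col //.
rewrite (big_ord_widen _ (fun k => mixing a b j k
  * sink_col (renewed_a a b) (renewed_b a b) k i) (ltn_ord j)).
rewrite big_mkcond; apply: eq_bigr => k _; rewrite !mxE ltnS mulrC.
by case: leqP => // jk; rewrite mixing_gt // mulr0.
Qed.

End Renewal.

Section Positivity.
Variable F : realFieldType.

Lemma sink_col_ge0 (a b : nat -> nat -> F) j s :
  (forall r t, 0 < a r t) -> (forall r t, 0 < b r t) -> 0 <= sink_col a b j s.
Proof.
have H (al be f : nat -> F) t : (forall t, 0 < al t) -> (forall t, 0 < be t) ->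
    (forall t, 0 <= f t) -> 0 <= crossing al be (descent f) t.
  by move=> ha hb hf; apply: addr_ge0; apply: mulr_ge0; rewrite ?sumr_ge0 // ltW.
elim: j s a b => [|j IHj] s a b ha hb; apply: H => // -[|t] //=; rewrite ?ler0n //.
by apply: IHj => r v; [exact: ha | exact: hb].
Qed.

Lemma det_sink_mx_gt0 (a b : nat -> nat -> F) n :
  (forall r t, 0 < a r t) -> (forall r t, 0 < b r t) -> 0 < \det (sink_mx a b n).
Proof.
elim: n a b => [|n IHn] a b ha hb; first by rewrite det_mx00.
have c0 r t : 0 < total_wt a b r t by rewrite addr_gt0.
rewrite det_sink_mx => [|r t]; last exact: lt0r_neq0.
rewrite mulr_gt0 ?prodr_gt0 // IHn // => r t; by rewrite !(mulr_gt0, invr_gt0).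
Qed.

End Positivity.

(** * Paths in the DR graph *)

Section Paths.
Variables (R : rcfType) (n : nat) (a b : nat -> nat -> R).
Implicit Types (u v w : dr_vertex n).

Let edge := @dr_edge n.
Let wt := @dr_weight R n a b.
Let paths := @weighted_paths R n a b.

Definition paths_of_length l u v : R :=
  \sum_(p : l.-tuple (dr_vertex n) | path edge u p && (last u p == v))
    path_weight a b u p.

Lemma paths_of_length0 u v : paths_of_length 0 u v = (u == v)%:R.
Proof.
rewrite /paths_of_length big_mkcond (big_pred1 [tuple]) /=; last first.
  by move=> p; rewrite [p]tuple0 /= eqxx.
by rewrite /path_weight big_nil; case: eqP.
Qed.

Lemma paths_of_lengthS l u v : paths_of_length l.+1 u v =
  \sum_(w | edge u w) wt u w * paths_of_length l w v.
Proof.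
under [RHS]eq_bigr do rewrite mulr_sumr.
rewrite pair_big_dep /=.
rewrite /paths_of_length.
rewrite (reindex (fun p : dr_vertex n * l.-tuple _ => [tuple of p.1 :: p.2])) /=.
  apply: eq_big => [[w p]|[w p] _] /=; first by rewrite andbA.
  by rewrite /path_weight /= big_cons.
exists (fun p => (thead p, [tuple of behead p])) => [[w p] _|p _] /=.
  by congr pair; apply: val_inj.
by rewrite [RHS]tuple_eta.
Qed.

(** The first step is split off.  Paths of length [#|dr_vertex n|] do not
    exist, so the range of lengths may be extended by one, which makes room
    for the shift of the length. *)
Lemma weighted_paths_recl u v : paths u v =
  (u == v)%:R + \sum_(w | edge u w) wt u w * paths w v.
Proof.
transitivity (\sum_(l < #|dr_vertex n|.+1) paths_of_length l u v).
  rewrite big_ord_recr /= [X in _ + X]big1 ?addr0 // => p /andP[/dr_path_size].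
  by rewrite size_tuple ltnn.
rewrite big_ord_recl paths_of_length0; congr (_ + _).
under eq_bigr do rewrite paths_of_lengthS.
by rewrite exchange_big; apply: eq_bigr => w _; rewrite mulr_sumr.
Qed.

Lemma az_black_dr_point u : az_black n (dr_point u) = (0 < u.2)%N.
Proof.
case: u => r s; apply/idP/idP => [/existsP[j /existsP[k /eqP[_ /= h]]]|/= s0].
  by lia.
have hk : (s.-1 < n)%N by have := ltn_ord s; lia.
apply/existsP; exists r; apply/existsP; exists (Ordinal hk).
by apply/eqP; congr pair => /=; lia.
Qed.

Lemma az_white_dr_white v : az_white n (dr_white v) = (0 < v.1)%N.
Proof.
case: v => r s; apply/idP/idP => [/existsP[j /existsP[k /eqP[/= h _]]]|/= r0].
  by lia.
have hk : (r.-1 < n)%N by have := ltn_ord r; lia.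
apply/existsP; exists (Ordinal hk); apply/existsP; exists s.
by apply/eqP; congr pair => /=; lia.
Qed.

Lemma dr_displ u v : dr_white v - dr_point u =
  (2 * (v.1 : nat)%:Z - 2 * (u.1 : nat)%:Z - 1,
   2 * (v.2 : nat)%:Z - 2 * (u.2 : nat)%:Z + 1).
Proof. by congr pair => /=; lia. Qed.

(** A vertex on the bottom row is not black and one in column 0 is not white,
    hence the two positivity conditions. *)
Lemma dr_edgeE u v : edge u v =
  [&& (0 < u.2)%N, (0 < v.1)%N &
   [|| (v.1 == u.1 :> nat) && (u.2 == v.2.+1 :> nat),
       (v.1 == u.1.+1 :> nat) && (u.2 == v.2 :> nat) |
       (v.1 == u.1.+1 :> nat) && (u.2 == v.2.+1 :> nat)]].
Proof.
rewrite /edge /dr_edge /az_edge az_black_dr_point az_white_dr_white dr_displ.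
case: u v => u1 u2 [v1 v2]; rewrite !inE -!pair_eqE /pair_eq /=; lia.
Qed.

Lemma dr_weight_down u v : v.1 = u.1 :> nat -> u.2 = v.2.+1 :> nat -> wt u v = 1.
Proof.
case: u v => u1 u2 [v1 v2] /=.
rewrite /wt /dr_weight /az_weight dr_displ -!pair_eqE /pair_eq /= => -> ->.
by rewrite ifT //; lia.
Qed.

Lemma dr_weight_right u v : v.1 = u.1.+1 :> nat -> u.2 = v.2 :> nat ->
  (0 < u.2)%N -> wt u v = a u.1 u.2.-1.
Proof.
case: u v => u1 u2 [v1 v2] /= h1 h2 h3.
rewrite /wt /dr_weight /az_weight dr_displ -!pair_eqE /pair_eq /=.
rewrite h1 -h2 ifF; last by lia.
rewrite ifF; last by lia.
rewrite ifT; last by lia.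
by congr (a _ _); rewrite /black_r /black_s /=; lia.
Qed.

Lemma dr_weight_diag u v : v.1 = u.1.+1 :> nat -> u.2 = v.2.+1 :> nat ->
  wt u v = b u.1 v.2.
Proof.
case: u v => u1 u2 [v1 v2] /= h1 h2.
rewrite /wt /dr_weight /az_weight dr_displ -!pair_eqE /pair_eq /=.
rewrite h1 h2 ifF; last by lia.
rewrite ifF; last by lia.
rewrite ifF; last by lia.
rewrite ifT; last by lia.
by congr (b _ _); rewrite /black_r /black_s /= ?h2; lia.
Qed.

Lemma sum_dr_edge (r s : nat) (f : dr_vertex n -> R) : (r <= n)%N -> (s < n)%N ->
  let u := (inord r, inord s.+1) in
  \sum_(w | edge u w) wt u w * f w =
  (if (0 < r)%N then f (inord r, inord s) else 0)
  + (if (r < n)%N then a r s * f (inord r.+1, inord s.+1)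
                       + b r s * f (inord r.+1, inord s) else 0).
Proof.
move=> rn sn u.
pose l : seq (dr_vertex n) := (if (0 < r)%N then [:: (inord r, inord s)] else [::])
  ++ (if (r < n)%N
      then [:: (inord r.+1, inord s.+1); (inord r.+1, inord s)] else [::]).
have E : edge u =i l.
  move=> [w1 w2]; rewrite [_ \in _]dr_edgeE /l mem_cat /= inordK // inordK //.
  have w1n := ltn_ord w1.
  have nilE : ((w1, w2) \in ([::] : seq (dr_vertex n))) = false by [].
  case: ifP => r0; case: ifP => rn';
    rewrite ?nilE ?inE -?pair_eqE /pair_eq /= -?val_eqE /= ?inordK //; lia.
rewrite (eq_bigl (mem l)); last exact: E.
rewrite -big_uniq; last first.
  rewrite /l; case: ifP => r0; case: ifP => rn' //=;
    rewrite ?inE -?pair_eqE /pair_eq /= -?val_eqE /= ?inordK //; lia.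
have D : (0 < r)%N -> wt u (inord r, inord s) = 1.
  by move=> r0; rewrite dr_weight_down //= ?inordK //; lia.
have A : (r < n)%N -> wt u (inord r.+1, inord s.+1) = a r s.
  by move=> r0; rewrite dr_weight_right //= ?inordK //; lia.
have B : (r < n)%N -> wt u (inord r.+1, inord s) = b r s.
  by move=> r0; rewrite dr_weight_diag //= ?inordK //; lia.
rewrite big_cat /=; congr (_ + _).
  by case: ifP => r0; rewrite ?big_nil // big_seq1 D // mul1r.
by case: ifP => r0; rewrite ?big_nil // !big_cons big_nil A // B // addr0.
Qed.

End Paths.

(** * The path matrix as a product of crossings and descents *)

Section SinkColumns.
Variables (R : rcfType) (n : nat) (a b : nat -> nat -> R) (J : nat).
Hypothesis Jn : (J < n)%N.

Let sink : dr_vertex n := (inord J.+1, ord0).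

Definition paths_from (r s : nat) : R :=
  weighted_paths a b (inord r, inord s) sink.

Lemma paths_from_bottom r : (r <= n)%N -> paths_from r 0 = (r == J.+1)%:R.
Proof.
move=> rn; rewrite /paths_from weighted_paths_recl big1 ?addr0; last first.
  by move=> w; rewrite dr_edgeE /= inordK.
by rewrite -pair_eqE /pair_eq /= -!val_eqE /= !inordK // andbT.
Qed.

Lemma paths_fromS r s : (r <= n)%N -> (s < n)%N -> paths_from r s.+1 =
  (if (0 < r)%N then paths_from r s else 0)
  + (if (r < n)%N then a r s * paths_from r.+1 s.+1
                       + b r s * paths_from r.+1 s else 0).
Proof.
move=> rn sn; rewrite /paths_from weighted_paths_recl sum_dr_edge //.
rewrite -pair_eqE /pair_eq /= -!val_eqE /=.
by rewrite (inordK (_ : s.+1 < n.+1)%N) // andbF add0r.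
Qed.

(** The weight of the paths to the sink that leave column [r] for the next one
    directly from the height [s + 1]. *)
Definition exits (r s : nat) : R :=
  if (r < n)%N then crossing (a r) (b r) (paths_from r.+1) s else 0.

(** A path entering a column to the right of column 0 moves down to some height
    [t], where it either ends, which requires the right column and [t = 0], or
    crosses to the next column. *)
Lemma paths_from_descent r s : (0 < r <= n)%N -> (s <= n)%N ->
  paths_from r s =
  descent (fun t => (r == J.+1)%:R * bottom R t + raise (exits r) t) s.
Proof.
move=> /andP[r0 rn]; elim: s => [_|s IHs sn].
  by rewrite /descent big_ord1 paths_from_bottom //= addr0 /bottom mulr1.
rewrite paths_fromS // r0 IHs ?(ltnW sn) // /descent [RHS]big_ord_recr /=; congr (_ + _).
rewrite /bottom mulr0 add0r /exits; case: ifP => // _; by rewrite /crossing addrC.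
Qed.


(** One step of the backward recursion over the columns; [f] is left free so
    that the three positions of [r] relative to the column of the sink are
    instances. *)
Lemma exitsE r s (f : nat -> R) : (r < n)%N -> (s < n)%N ->
  (forall t, (t <= s.+1)%N ->
     (r == J)%:R * bottom R t + raise (exits r.+1) t = f t) ->
  exits r s = crossing (a r) (b r) (descent f) s.
Proof.
move=> rn sn E; rewrite /exits rn /crossing !paths_from_descent ?(ltnW sn) //.
rewrite /descent eqSS.
congr (_ * _ + _ * _); apply: eq_bigr => t _; apply: E; have := ltn_ord t; lia.
Qed.

Lemma exits_gt r s : (J < r)%N -> (s < n)%N -> exits r s = 0.
Proof.
elim: {r}(n - r)%N {-2}r (erefl (n - r)%N) s => [|k IHk] r rk s Jr sn.
  by rewrite /exits ifF //; lia.
rewrite (exitsE (f := fun=> 0)) ?/crossing ?/descent; try lia.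
  by rewrite !big1 // !mulr0 addr0.
move=> [|t] ht; rewrite gtn_eqF // mul0r add0r //=; apply: IHk; lia.
Qed.

Lemma exits_sink_col r s : (r <= J)%N -> (s < n)%N ->
  exits r s = sink_col (iter r (@tail R) a) (iter r (@tail R) b) (J - r) s.
Proof.
have iter_tail (c : nat -> nat -> R) m : iter m (@tail R) c 0%N = c m.
  by elim: m c => // m IHm c; rewrite iterSr IHm.
elim: {r}(J - r)%N {-2}r (erefl (J - r)%N) s => [|k IHk] r rk s rJ sn;
  rewrite rk /= !iter_tail.
  apply: exitsE => [||[|t] ht]; try lia.
    by rewrite /= addr0 (_ : r == J) ?mul1r //; lia.
  by rewrite /= exits_gt ?addr0 /bottom ?mulr0 //; lia.
apply: exitsE => [||[|t] ht]; try lia.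
  by rewrite /= addr0 ltn_eqF ?mul0r //; lia.
rewrite ltn_eqF ?mul0r ?add0r /=; last lia.
have rk1 : (J - r.+1)%N = k by lia.
by rewrite -rk1 -!iterS; apply: IHk; lia.
Qed.

End SinkColumns.

Lemma path_mx_sink_mx (R : rcfType) n (a b : nat -> nat -> R) :
  path_mx n a b = sink_mx a b n.
Proof.
apply/matrixP => i j; rewrite !mxE -[in RHS](subn0 j).
have n0 : (0 < n)%N by case: (n) i => [[]|].
rewrite -[RHS](exits_sink_col a b (ltn_ord j) (leq0n j) (ltn_ord i)).
transitivity (paths_from n a b j 0 i.+1).
  congr weighted_paths; congr pair; apply: val_inj;
    by rewrite /= inordK // ltnS ltn_ord.
by rewrite paths_fromS ?ltn_ord //= n0 add0r /exits n0 /crossing addrC.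
Qed.

(** * The ordering of the vertices *)

Section Indexing.
Variable n : nat.
Implicit Type i : 'I_(n + n * n).

Lemma index_gt0 i : (0 < n)%N.
Proof. by move: (nat_of_ord i) (ltn_ord i) => k; case: (n). Qed.

(** The DR vertices that carry the white and the black vertex of a given index;
    they coincide beyond the first [n] indices ([black_of_rshift]). *)
Definition white_of i : dr_vertex n :=
  (inord (i %% n).+1, inord (if (i < n)%N then 0%N else (n.+1 - i %/ n)%N)).

Definition black_of i : dr_vertex n :=
  (inord (if (i < n)%N then 0%N else (i %% n).+1),
   inord (if (i < n)%N then i.+1 else (n.+1 - i %/ n)%N)).

Lemma white_of1 i : (white_of i).1 = (i %% n).+1 :> nat.
Proof.
have n0 := index_gt0 i.
by rewrite /= inordK // ltnS ltn_pmod.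
Qed.

Lemma white_of2 i :
  (white_of i).2 = (if (i < n)%N then 0%N else (n.+1 - i %/ n)%N) :> nat.
Proof.
have n0 := index_gt0 i.
rewrite /= inordK //; case: (ltnP i n) => // hi.
by have : (0 < i %/ n)%N; [rewrite divn_gt0 | lia].
Qed.

Lemma black_of1 i :
  (black_of i).1 = (if (i < n)%N then 0%N else (i %% n).+1) :> nat.
Proof.
have n0 := index_gt0 i.
by rewrite /= inordK //; case: ifP => // _; rewrite ltnS ltn_pmod.
Qed.

Lemma black_of2 i :
  (black_of i).2 = (if (i < n)%N then i.+1 else (n.+1 - i %/ n)%N) :> nat.
Proof.
have n0 := index_gt0 i.
rewrite /= inordK //; case: (ltnP i n) => // hi.
by have : (0 < i %/ n)%N; [rewrite divn_gt0 | lia].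
Qed.

Lemma black_of2_gt0 i : (0 < (black_of i).2)%N.
Proof.
have n0 := index_gt0 i.
rewrite black_of2; case: ifP => // _.
by rewrite subn_gt0 ltn_divLR // mulSn ltn_ord.
Qed.

Lemma index_quo_le i : (i %/ n <= n)%N.
Proof.
have n0 := index_gt0 i.
by rewrite -ltnS ltn_divLR // mulSn ltn_ord.
Qed.

Lemma dr_white_white_of i : dr_white (white_of i) = wvert n i.+1.
Proof.
have n0 := index_gt0 i.
have := index_quo_le i; rewrite /dr_white /dr_point white_of1 white_of2 /wvert subn1 /=.
by case: ltnP => hi hq; congr pair => /=; rewrite ?(modn_small hi); lia.
Qed.

Lemma dr_point_black_of i : dr_point (black_of i) = bvert n i.+1.
Proof.
have n0 := index_gt0 i.
have := index_quo_le i; rewrite /dr_point black_of1 black_of2 /bvert subn1 /=.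
by case: ltnP => hi hq; congr pair => /=; lia.
Qed.

Lemma white_of_inj : injective white_of.
Proof.
move=> i j E; apply: val_inj.
have := congr1 (fun v : dr_vertex n => v.1 : nat) E.
have := congr1 (fun v : dr_vertex n => v.2 : nat) E.
rewrite !white_of1 !white_of2 => h2 [h1].
have := index_quo_le i; have := index_quo_le j => qj qi.
rewrite /= (divn_eq i n) (divn_eq j n) h1; congr (_ * _ + _)%N.
move: h2; case: (ltnP i n) => hi; case: (ltnP j n) => hj h2; try lia.
by rewrite (divn_small hi) (divn_small hj).
Qed.

(** White vertices correspond to the DR vertices outside column 0, which turns
    sums over the matrix index into sums over the graph. *)
Lemma sum_white_of (V : zmodType) (f : dr_vertex n -> V) :
  \sum_i f (white_of i) = \sum_(v : dr_vertex n | (0 < v.1)%N) f v.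
Proof.
transitivity (\sum_(v in white_of @: [set: 'I_(n + n * n)]) f v).
  rewrite big_imset /=; last by move=> i j _ _; exact: white_of_inj.
  by apply: eq_bigl => i; rewrite inE.
apply: eq_bigl => v; apply/imsetP/idP => [[i _ ->]|]; first by rewrite white_of1.
case: v => r k /= r0; have hr := ltn_ord r; have hk := ltn_ord k.
have r1 : (r.-1 < n)%N by lia.
(* Bottom vertices come first; the other rows are listed from the top down. *)
pose m := (if k == 0%N :> nat then r.-1 else (n.+1 - k) * n + r.-1)%N.
have mn : (m < n + n * n)%N by rewrite /m; case: eqP => k0; nia.
have mm : (m %% n = r.-1)%N.
  by rewrite /m; case: eqP => _; rewrite ?modnMDl modn_small.
exists (Ordinal mn); first by rewrite inE.
rewrite [white_of (Ordinal mn)]surjective_pairing.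
congr pair; apply: ord_inj.
  by rewrite white_of1 /= mm; lia.
rewrite white_of2 /=.
have md : (k != 0 :> nat -> m %/ n = n.+1 - k)%N.
  move=> k0; rewrite /m (negbTE k0) divnMDl; last lia.
  by rewrite divn_small // addn0.
case: (eqVneq (k : nat) 0%N) => [k0|k0]; first by rewrite /m k0 /= r1.
rewrite md // ifF; first by lia.
by rewrite /m (negbTE k0); nia.
Qed.

Definition interior (i : 'I_(n * n)) : dr_vertex n := white_of (rshift n i).

Lemma black_of_rshift (i : 'I_(n * n)) : black_of (rshift n i) = interior i.
Proof. by rewrite /interior /black_of /white_of /= ltnNge leq_addr. Qed.

Lemma interior1 (i : 'I_(n * n)) : (interior i).1 = (i %% n).+1 :> nat.
Proof. by rewrite white_of1 /= modnDl. Qed.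

Lemma interior2 (i : 'I_(n * n)) : (interior i).2 = (n - i %/ n)%N :> nat.
Proof.
have n0 := index_gt0 (rshift n i).
by rewrite white_of2 /= ltnNge leq_addr /= divnDl // divnn n0 subSS.
Qed.

(** Rows are listed from the top down and from left to right, so a step down
    adds [n] to the index, a step to the right 1, and a diagonal step both. *)
Lemma interior_edge_lt (i j : 'I_(n * n)) :
  dr_edge (interior i) (interior j) -> (i < j)%N.
Proof.
have n0 := index_gt0 (rshift n i).
rewrite dr_edgeE !interior1 !interior2 !eqSS.
have := ltn_ord i; have := ltn_ord j; rewrite -!ltn_divLR // => qj qi.
rewrite [in (i < j)%N](divn_eq i n) [in (_ < j)%N](divn_eq j n).
move: (i %/ n)%N (j %/ n)%N (i %% n)%N (j %% n)%N qi qj => q q' m m'.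
move=> qi qj /and3P[_ _ /or3P[]] /andP[/eqP -> /eqP E].
- have -> : q' = q.+1 by lia.
  by rewrite mulSn; lia.
- have -> : q' = q by lia.
  by lia.
- have -> : q' = q.+1 by lia.
  by rewrite mulSn; lia.
Qed.

End Indexing.

(** * The Kasteleyn matrix acting on path weights *)

Section Kasteleyn.
Variables (R : rcfType) (n : nat) (a b : nat -> nat -> R).
Implicit Types u v : dr_vertex n.

Notation I := ('i%C : R[i]).
Let kappa u v : R[i] := kasteleyn a b (dr_point u) (dr_white v).

Lemma kasteleyn_loop u : kappa u u = I.
Proof.
rewrite /kappa /kasteleyn dr_displ -!pair_eqE /pair_eq /=.
by rewrite ifF ?ifT //; lia.
Qed.

(** The factor [i ^ (s - r)] at [(r, s)], written with natural exponents.  It is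
    determined up to a constant by [kasteleyn_edge]: each kind of step fixes
    how it changes, and the diagonal step agrees with a step to the right
    followed by one down. *)
Definition gauge u : R[i] := (- I) ^+ u.1 * I ^+ u.2.

Lemma kasteleyn_edge u v : dr_edge u v ->
  kappa u v * gauge v = - I * gauge u * (dr_weight a b u v)%:C%C.
Proof.
have ii : I * I = -1 by rewrite -expr2 sqr_i.
case: u v => u1 u2 [v1 v2]; rewrite dr_edgeE /= => /and3P[h1 h2 h].
rewrite /kappa /dr_weight /az_weight /kasteleyn dr_displ -!pair_eqE /pair_eq /gauge /=.
case/or3P: h => /andP[/eqP e1 /eqP e2]; rewrite e1 e2.
- do 2 (rewrite ifT; last by lia); rewrite exprS.
  by rewrite -[in LHS](opprK (1 : R[i])) -ii; ring.
- do 2 (rewrite ifF; last by lia); rewrite ifT; last by lia.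
  do 2 (rewrite ifF; last by lia); rewrite ifT; last by lia.
  by rewrite exprS; ring.
- do 3 (rewrite ifF; last by lia); rewrite ifT; last by lia.
  do 3 (rewrite ifF; last by lia); rewrite ifT; last by lia.
  by rewrite !exprS; ring.
Qed.

Lemma kasteleyn_nonedge u v : (0 < u.2)%N -> (0 < v.1)%N ->
  ~~ dr_edge u v -> u != v -> kappa u v = 0.
Proof.
case: u v => u1 u2 [v1 v2] h1 h2; rewrite dr_edgeE -pair_eqE /pair_eq -!val_eqE /=.
rewrite /kappa /kasteleyn dr_displ -!pair_eqE /pair_eq /= => h3 h4.
move: h1 h2 => /= h1 h2.
by do 4 (rewrite ifF; last by lia).
Qed.

(** By the first-step recurrence the steps out of [u] contribute [- i] times
    the value at [u]; the loop, present exactly when [u] is also white,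
    contributes [i] times that value. *)
Lemma kasteleyn_gauge_paths u t : (0 < u.2)%N -> t.2 = ord0 ->
  \sum_(v : dr_vertex n | (0 < v.1)%N)
    kappa u v * (gauge v * (weighted_paths a b v t)%:C%C) =
  if (0 < u.1)%N then 0 else - I * (gauge u * (weighted_paths a b u t)%:C%C).
Proof.
move=> u2 t2; rewrite (bigID (fun v => dr_edge u v)) /=.
have -> : \sum_(v : dr_vertex n | (0 < v.1)%N && dr_edge u v)
    kappa u v * (gauge v * (weighted_paths a b v t)%:C%C) =
    - I * (gauge u * (weighted_paths a b u t)%:C%C).
  rewrite (weighted_paths_recl a b u t).
  have -> : (u == t) = false by apply: contraTF u2 => /eqP ->; rewrite t2.
  rewrite add0r rmorph_sum !mulr_sumr /=; apply: eq_big => [v|v /andP[_ uv]].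
    by rewrite dr_edgeE; case: (0 < v.1)%N; rewrite ?andbF.
  by rewrite mulrA kasteleyn_edge // rmorphM /=; ring.
have [u1|u1] := posnP u.1.
  rewrite big1 ?addr0 // => v /andP[v1 uv].
  rewrite kasteleyn_nonedge ?mul0r //.
  by apply: contraTneq v1 => <-; rewrite u1.
rewrite (bigD1 u) /=; last by rewrite u1 dr_edgeE; lia.
rewrite kasteleyn_loop big1 ?addr0; first by rewrite mulNr addNr.
move=> v /andP[/andP[v1 uv] vu].
by rewrite kasteleyn_nonedge ?mul0r // eq_sym.
Qed.

Let K := kasteleyn_mx n a b.

Lemma kasteleyn_mxE i j : K i j = kappa (black_of i) (white_of j).
Proof. by rewrite mxE /kappa dr_point_black_of dr_white_white_of. Qed.

Lemma drsubmx_kasteleyn i j : drsubmx K i j = kappa (interior i) (interior j).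
Proof.
by rewrite -black_of_rshift -kasteleyn_mxE [LHS]mxE [LHS]mxE.
Qed.

(** Off the diagonal, the entries of this block sit on edges, which increase
    the index, so the block is upper triangular. *)
Lemma det_drsubmx_kasteleyn : \det (drsubmx K) = I ^+ (n * n).
Proof.
rewrite -det_tr det_trig.
  under eq_bigr => i _ do rewrite mxE drsubmx_kasteleyn kasteleyn_loop.
  by rewrite prodr_const card_ord.
apply/is_trig_mxP => i j ij; rewrite mxE drsubmx_kasteleyn.
rewrite kasteleyn_nonedge //.
- by rewrite -black_of_rshift black_of2_gt0.
- by rewrite white_of1.
- by apply/negP => /interior_edge_lt; rewrite ltnNge ltnW.
- by rewrite (inj_eq (@white_of_inj n)) (inj_eq (@rshift_inj _ _)) gt_eqF.
Qed.

(** The factor [i ^ (j + 1)] cancels the gauge at the sink of index [j], so that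
    the top block is the identity ([usubmx_solution]). *)
Definition solution : 'M[R[i]]_(n + n * n, n) := \matrix_(i, j)
  (gauge (white_of i) * (weighted_paths a b (white_of i) (lift ord0 j, ord0))%:C%C
   * I ^+ j.+1).

Definition gauged_path_mx : 'M[R[i]]_n := \matrix_(i, j)
  (- I * I ^+ i.+1 * I ^+ j.+1 * (path_mx n a b i j)%:C%C).

Lemma mul_kasteleyn_solution : K *m solution = col_mx gauged_path_mx 0.
Proof.
apply/matrixP => i j; rewrite mxE.
pose f v := kappa (black_of i) v * (gauge v *
  (weighted_paths a b v (lift ord0 j, ord0))%:C%C).
transitivity ((\sum_i f (white_of i)) * I ^+ j.+1).
  rewrite mulr_suml; apply: eq_bigr => k _.
  by rewrite kasteleyn_mxE mxE /f !mulrA.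
rewrite sum_white_of kasteleyn_gauge_paths ?black_of2_gt0 //.
case: (splitP i) => k ik.
  have -> : i = lshift _ k by apply: val_inj.
  have bk : black_of (lshift (n * n) k) = (ord0, lift ord0 k).
    rewrite [LHS]surjective_pairing; congr pair; apply: ord_inj.
      by rewrite black_of1 /= ltn_ord.
    by rewrite black_of2 /= ltn_ord.
  by rewrite col_mxEu bk /= !mxE /gauge expr0 mul1r ?lift0; ring.
have -> : i = rshift _ k by apply: val_inj.
by rewrite black_of_rshift interior1 col_mxEd mxE mul0r.
Qed.

Lemma usubmx_solution : usubmx solution = 1%:M.
Proof.
apply/matrixP => i j; rewrite !mxE.
have -> : white_of (lshift (n * n) i) = (lift ord0 i, ord0).
  rewrite [LHS]surjective_pairing; congr pair; apply: ord_inj.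
    by rewrite white_of1 /= modn_small // lift0.
  by rewrite white_of2 /= ltn_ord.
rewrite weighted_paths_recl big1 ?addr0 => [|v]; last by rewrite dr_edgeE.
rewrite -pair_eqE /pair_eq eqxx andbT /= (inj_eq (@lift_inj _ _)).
case: eqP => [->|_]; last by rewrite mulr0 mul0r.
rewrite mulr1 /gauge /= expr0 mulr1 -exprMn mulNr -expr2 sqr_i opprK.
by rewrite expr1n.
Qed.

Lemma normc_i : `|I| = 1.
Proof. by rewrite normc_def /= expr0n add0r expr1n sqrtr1. Qed.

Lemma drsubmx_kasteleyn_unit : drsubmx K \in unitmx.
Proof.
rewrite unitmxE det_drsubmx_kasteleyn unitrX // unitfE.
by rewrite -normr_eq0 normc_i oner_neq0.
Qed.

(** The bottom rows of [K *m solution = col_mx gauged_path_mx 0] express the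
    bottom block of [solution] as [- invmx D *m C]; the top rows then are the
    Schur complement. *)
Lemma schur_kasteleyn :
  ulsubmx K - ursubmx K *m invmx (drsubmx K) *m dlsubmx K = gauged_path_mx.
Proof.
have Du := drsubmx_kasteleyn_unit.
have := mul_kasteleyn_solution.
rewrite -{1}[K]submxK -[solution]vsubmxK usubmx_solution mul_block_col.
rewrite !mulmx1 => /eq_col_mx[E1 /eqP].
rewrite addrC addr_eq0 => /eqP E2.
have -> : ursubmx K *m invmx (drsubmx K) *m dlsubmx K
    = - (ursubmx K *m dsubmx solution).
  by rewrite -mulmxA -[dlsubmx K]opprK -E2 !mulmxN mulKmx.
by rewrite opprK.
Qed.

Lemma norm_gauged_path_mx i j :
  `|gauged_path_mx i j| = `|path_mx n a b i j|%:C%C.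
Proof.
rewrite mxE !normrM normrN !normrX normc_i !expr1n !mul1r.
by rewrite normc_def /= expr0n addr0 sqrtr_sqr.
Qed.

Lemma det_gauged_path_mx :
  `|\det gauged_path_mx| = `|\det (path_mx n a b)|%:C%C.
Proof.
pose al := \row_(i < n) (- I * I ^+ i.+1); pose be := \row_(j < n) (I ^+ j.+1).
have -> : gauged_path_mx =
    diag_mx al *m map_mx (real_complex R) (path_mx n a b) *m diag_mx be.
  by apply/matrixP => i j; rewrite mul_mx_diag mul_diag_mx !mxE; ring.
rewrite !det_mulmx !det_diag det_map_mx !normrM !normr_prod.
rewrite big1 => [|i _]; last first.
  by rewrite mxE normrM normrN normrX normc_i expr1n mulr1.
rewrite [X in _ * X]big1 => [|i _]; last by rewrite mxE normrX normc_i expr1n.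
by rewrite mul1r mulr1 normc_def /= expr0n addr0 sqrtr_sqr.
Qed.

End Kasteleyn.

(** * Block inversion and conclusion *)

Section Schur.
Variables (F : fieldType) (m n : nat).
Variables (A : 'M[F]_m) (B : 'M[F]_(m, n)) (C : 'M[F]_(n, m)) (D : 'M[F]_n).

Lemma block_mx_inv_schur (S := A - B *m invmx D *m C) :
  D \in unitmx -> S \in unitmx ->
  block_mx A B C D *m
  block_mx (invmx S) (- (invmx S *m B *m invmx D))
           (- (invmx D *m C *m invmx S))
           (invmx D + invmx D *m C *m invmx S *m B *m invmx D) = 1%:M.
Proof.
move=> uD uS; rewrite mulmx_block scalar_mx_block.
rewrite !mulmxDr !mulmxN !mulmxA (mulmxV uD) mul1mx subrr.
have AS : A *m invmx S = 1%:M + B *m invmx D *m C *m invmx S.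
  by apply/eqP; rewrite -subr_eq -mulmxBl mulmxV.
rewrite AS !mulmxDl !mul1mx addrK [X in block_mx _ X]addrC subrr.
by rewrite addrCA [- _ + _]addrC subrr addr0.
Qed.

End Schur.

(** Urban renewal is stated for weights that are positive everywhere; weights
    outside the diamond do not enter [path_mx] and are set to 1. *)
Lemma path_mx_ge0_det_gt0 (R : rcfType) (n : nat) (a b : nat -> nat -> R)
    (ha : forall r s : nat, (r < n)%N -> (s < n)%N -> 0 < a r s)
    (hb : forall r s : nat, (r < n)%N -> (s < n)%N -> 0 < b r s) :
  (forall i j, 0 <= path_mx n a b i j) /\ 0 < \det (path_mx n a b).
Proof.
pose ext (c : nat -> nat -> R) r s := if (r < n)%N && (s < n)%N then c r s else 1.
have extP (c : nat -> nat -> R) :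
    (forall r s, (r < n)%N -> (s < n)%N -> 0 < c r s) -> forall r s, 0 < ext c r s.
  by move=> hc r s; rewrite /ext; case: ifP => // /andP[]; exact: hc.
have -> : path_mx n a b = sink_mx (ext a) (ext b) n.
  rewrite path_mx_sink_mx; apply/matrixP => i j; rewrite !mxE.
  by apply: eq_sink_col => r t rj ti;
    rewrite /ext (leq_ltn_trans rj) ?(leq_ltn_trans ti).
split; last by apply: det_sink_mx_gt0; exact: extP.
by move=> i j; rewrite mxE; apply: sink_col_ge0; exact: extP.
Qed.

Theorem theorem4p1 (R : rcfType) (n : nat) (a b : nat -> nat -> R)
    (hn : (1 <= n)%N)
    (ha : forall r s : nat, (r < n)%N -> (s < n)%N -> 0 < a r s)
    (hb : forall r s : nat, (r < n)%N -> (s < n)%N -> 0 < b r s) :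
  let K : 'M[R[i]]_(n + n * n) := kasteleyn_mx n a b in
  let A := ulsubmx K in
  let B := ursubmx K in
  let C := dlsubmx K in
  let D := drsubmx K in
  let Wt : 'M[R[i]]_n := A - B *m invmx D *m C in
  let W : 'M[R]_n := path_mx n a b in
  [/\ D \in unitmx, Wt \in unitmx & K \in unitmx]
  /\ [/\ forall i j : 'I_n, (W i j)%:C%C = `|Wt i j|,
         (\det W)%:C%C = `|\det Wt|
       & invmx K =
           block_mx (invmx Wt)
                    (- (invmx Wt *m B *m invmx D))
                    (- (invmx D *m C *m invmx Wt))
                    (invmx D + invmx D *m C *m invmx Wt *m B *m invmx D)].
Proof.
move=> K A B C D Wt W.
have [W0 detW] := path_mx_ge0_det_gt0 ha hb.
have WtE : Wt = gauged_path_mx n a b by exact: schur_kasteleyn.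
have uD : D \in unitmx by exact: drsubmx_kasteleyn_unit.
have detE : (\det W)%:C%C = `|\det Wt|.
  by rewrite WtE det_gauged_path_mx gtr0_norm.
have uWt : Wt \in unitmx.
  by rewrite unitmxE unitfE -normr_eq0 -detE (inj_eq (@complexI R) _ 0) lt0r_neq0.
have KE := block_mx_inv_schur uD uWt; rewrite submxK in KE.
have [uK _] := mulmx1_unit KE.
split; split=> // [i j|].
  by rewrite WtE norm_gauged_path_mx ger0_norm.
by rewrite -[LHS]mulmx1 -[in LHS]KE mulKmx.
Qed.
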